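(* Let $n$ be a positive integer. If $G$ is a finite simple graph of order $n$ (i.e., with $n$ vertices) with $\kappa_3(G)=2$, then its number of edges satisfies $e(G)\geq \lceil \tfrac{6}{5}n\rceil$. Moreover, this lower bound is sharp for all $n\geq 4$ with $n\neq 9,10$: for every such $n$ there exists a finite simple graph $G$ of order $n$ with $\kappa_3(G)=2$ and $e(G)=\lceil \tfrac{6}{5}n\rceil$.
   Context: All graphs are finite and simple. For a nontrivial connected graph $G$ and a set $S$ of $3$ vertices of $G$, $\kappa(S)$ denotes the maximum number $\ell$ of edge-disjoint trees $T_1,\dots,T_\ell$ in $G$, each containing all vertices of $S$, such that $V(T_i)\cap V(T_j)=S$ for every pair of distinct $i,j$ (so the trees are internally disjoint). The generalized $3$-connectivity is $\kappa_3(G)=\min\{\kappa(S)\}$, the minimum taken over all $3$-subsets $S$ of $V(G)$. $e(G)$ denotes the number of edges of $G$. *)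

(* Defs.v *)
From mathcomp Require Import all_boot.

Set Implicit Arguments.
Unset Strict Implicit.
Unset Printing Implicit Defensive.

Record sgraph := SGraph {
  vertex :> finType;
  adj : rel vertex;
  adj_sym : symmetric adj;
  adj_irr : irreflexive adj }.

Definition edges (G : sgraph) : {set {set G}} :=
  [set [set p.1; p.2] | p in [set p : G * G | adj p.1 p.2]].

(* A candidate subgraph: its vertices and its edges. *)
Definition presubgraph (G : sgraph) : Type := ({set G} * {set {set G}})%type.

Section Trees.
Variable G : sgraph.
Implicit Types (S : {set G}) (H : presubgraph G).

Definition is_subgraph H : bool :=
  (H.2 \subset edges G) && [forall A in H.2, A \subset H.1].

Definition sub_adj H : rel G := [rel x y | [set x; y] \in H.2].

Definition sub_connected H : bool :=
  (H.1 != set0) && [forall x in H.1, forall y in H.1, connect (sub_adj H) x y].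

(* Vertices of a cycle are distinct, so length at most #|G| is no restriction
   (see sub_acyclicP). *)
Definition sub_acyclic H : bool :=
  [forall k : 'I_(#|G|.+1), forall c : k.-tuple G,
     (2 < k) ==> ~~ ucycleb (sub_adj H) c].

Lemma sub_acyclicP H :
  reflect (forall c : seq G, 2 < size c -> ~ ucycle (sub_adj H) c)
          (sub_acyclic H).
Proof.
apply: (iffP forallP) => [acyc c c_gt2 cyc | acyc k].
  have lt_c : size c < #|G|.+1.
    by rewrite ltnS; case/andP: cyc => _ /card_uniqP <-; apply: max_card.
  have /forallP/(_ (in_tuple c)) := acyc (Ordinal lt_c).
  by rewrite /= c_gt2 /= => /negP; apply.
by apply/forallP=> c; apply/implyP=> k_gt2; apply/negP/acyc; rewrite size_tuple.
Qed.

Definition is_tree H : bool :=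
  [&& is_subgraph H, sub_connected H & sub_acyclic H].

(* A set of trees loses nothing against an indexed family T_1, ..., T_l when
   S has at least two vertices: every tree then has an edge, so edge-disjoint
   trees are distinct. *)
Definition internally_disjoint_trees S (F : {set presubgraph G}) : bool :=
  [forall H in F, is_tree H && (S \subset H.1)] &&
  [forall H in F, forall H' in F, (H != H') ==>
     [disjoint H.2 & H'.2] && (H.1 :&: H'.1 == S)].

Definition kappa S : nat :=
  \max_(F : {set presubgraph G} | internally_disjoint_trees S F) #|F|.

End Trees.

(* The value 0 when G has fewer than three vertices is a convention: there is
   then no 3-subset to minimize over.  A disconnected G of order at least 3 gets
   the value 0, as usual, since no tree meets two components. *)
Definition kappa3 (G : sgraph) : nat :=
  if [pick S : {set G} | #|S| == 3] is Some S0
  then kappa [arg min_(S < S0 | #|S| == 3) kappa S]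
  else 0.

(* Main.v *)
Require Import Defs.
From mathcomp Require Import all_boot all_order all_algebra zify lra.

(* Lower bound.  An edge joining two vertices u, v of degree 2 lies in at most
   one of two internally disjoint trees containing u and v, and in that tree it
   would be a whole component; so when kappa3 G = 2 the set X of vertices of
   degree 2 is independent.  Hence 2|X| <= e, and 2e >= 3n - |X|, which gives
   5e >= 6n.  Conversely 5e <= 6n + 4 forces a vertex of degree at most 2, so in
   the construction only kappa3 >= 2 has to be checked.

   Sharpness.  For n = 5k take the Moebius ladder with k >= 3 rungs and subdivide
   every edge once.  A rung with the pieces of rail following its two ends forms
   a block of five vertices.  If k >= 4, three vertices miss some block; deleting
   the rung of that block leaves a subdivision of the graph for k - 1, so trees
   lift, and everything reduces to k = 3, the subdivided K_{3,3}, which is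
   checked by computation.  For n = 5k - j with j <= 4, suppress j of the
   vertices of degree 2.  The cases 4 <= n <= 8 are checked by computation. *)

Set Implicit Arguments.
Unset Strict Implicit.
Unset Printing Implicit Defensive.

(** * Minimum degree and the lower bound *)

Definition nbhd (G : sgraph) (x : G) : {set G} := [set y | adj x y].

Lemma adj_neq (G : sgraph) (x y : G) : adj x y -> x != y.
Proof. by apply: contraTneq => ->; rewrite adj_irr. Qed.

Lemma set2_eq (T : finType) (a b c d : T) :
  [set a; b] = [set c; d] -> a = c /\ b = d \/ a = d /\ b = c.
Proof.
move=> e.
have := set21 a b; have := set22 a b; rewrite e !inE.
have := set21 c d; have := set22 c d; rewrite -e !inE.
by move=> /orP[] /eqP ? /orP[] /eqP ? /orP[] /eqP ? /orP[] /eqP ?; subst; auto.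
Qed.

Lemma mem_edges (G : sgraph) (x y : G) : ([set x; y] \in edges G) = adj x y.
Proof.
apply/imsetP/idP => [[[a b]]|xy]; last by exists (x, y); rewrite ?inE.
by rewrite inE /= => ab /set2_eq[[-> ->]|[-> ->]] //; rewrite adj_sym.
Qed.

Lemma edgesP (G : sgraph) (A : {set G}) :
  reflect (exists x y, adj x y /\ A = [set x; y]) (A \in edges G).
Proof.
apply: (iffP imsetP) => [[[a b]]|[x [y [xy ->]]]]; last by exists (x, y); rewrite ?inE.
by rewrite inE /= => ab ->; exists a, b.
Qed.

Lemma card_nbhd (G : sgraph) (x : G) :
  #|nbhd x| = #|[set A in edges G | x \in A]|.
Proof.
rewrite -(@card_in_imset _ _ (fun y => [set x; y])) => [|y z]; last first.
  rewrite !inE => xy xz /set2_eq[[] //|[xz' yx]].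
  by move: (adj_neq xz); rewrite xz' eqxx.
apply: eq_card => A; rewrite inE; apply/imsetP/andP => [[y]|[/edgesP[y [z [yz ->]]]]].
  by rewrite inE => xy ->; rewrite mem_edges set21.
case/set2P=> ->; first by exists z; rewrite ?inE.
by exists y; rewrite ?inE 1?adj_sym // setUC.
Qed.

Lemma sum_deg (G : sgraph) (X : {set G}) :
  \sum_(x in X) #|nbhd x| = \sum_(A in edges G) #|A :&: X|.
Proof.
transitivity (\sum_(x in X) \sum_(A in edges G | x \in A) 1).
  by apply: eq_bigr => x _; rewrite card_nbhd -sum1dep_card.
rewrite (exchange_big_dep (mem (edges G))) /=; last by move=> x A _ /andP[].
apply: eq_bigr => A eA; rewrite -sum1dep_card.
by apply: eq_bigl => x; rewrite eA andbC.
Qed.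

Lemma sum_deg_le (G : sgraph) : \sum_(x : G) #|nbhd x| <= 2 * #|edges G|.
Proof.
have := @sum_deg G setT; under eq_bigl do rewrite inE; move=> ->.
rewrite mulnC -sum_nat_const; apply: leq_sum => A /edgesP[x [y [_ ->]]].
by rewrite setIT cards2; case: (_ != _).
Qed.

Definition independent (G : sgraph) (X : {set G}) :=
  {in X &, forall x y, ~~ adj x y}.

(** An edge that meets an independent set has only one endpoint in it, so the degree sum counts no
    edge twice. *)
Lemma sum_deg_independent (G : sgraph) (X : {set G}) :
  independent X ->
  \sum_(x in X) #|nbhd x| <= #|[set A in edges G | ~~ [disjoint A & X]]|.
Proof.
move=> indX; rewrite sum_deg -sum1dep_card big_mkcondr.
apply: leq_sum => A /edgesP[x [y [xy ->]]].
rewrite -setI_eq0 -cards_eq0; case: ifPn; last by rewrite negbK => /eqP ->.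
move=> _; rewrite leqNgt; apply: contraL xy => c2.
have /eqP eqA : [set x; y] :&: X == [set x; y].
  rewrite eqEcard subsetIl (leq_trans _ c2) // cards2; by case: (_ != _).
have := set21 x y; have := set22 x y; rewrite -eqA !inE => /andP[_ yX] /andP[_ xX].
exact: indX.
Qed.

(** * Degrees as upper bounds for [kappa] *)

Lemma leq_kappa (G : sgraph) (S : {set G}) (m : nat) :
  0 < m -> m <= kappa S ->
  exists2 F : {set presubgraph G}, internally_disjoint_trees S F & m <= #|F|.
Proof.
move=> m_gt0; rewrite /kappa; elim/big_ind: _ => [|p q IHp IHq|F okF mF].
- by rewrite leqNgt m_gt0.
- by rewrite leq_max => /orP[].
- by exists F.
Qed.

Lemma kappa3_min (G : sgraph) : 2 < #|G| ->
  exists2 S : {set G}, #|S| = 3 & kappa3 G = kappa S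
    /\ forall T : {set G}, #|T| = 3 -> kappa S <= kappa T.
Proof.
move=> G_gt2; rewrite /kappa3; case: pickP => [S0 S0P|noS].
  case: arg_minnP => //= S /eqP S3 minS; exists S => //; split=> // T /eqP.
  exact: minS.
(* The 3-subsets are counted by a binomial coefficient, positive as [2 < #|G|]; so the default 0 of
   [kappa3] is excluded. *)
have : 0 < #|[set A : {set G} | A \subset [set: G] & #|A| == 3]|.
  by rewrite cards_draws cardsT bin_gt0.
by case/card_gt0P=> S; rewrite inE noS andbF.
Qed.

Lemma kappa3_gt0 (G : sgraph) : 0 < kappa3 G -> 2 < #|G|.
Proof.
rewrite /kappa3; case: pickP => // S /eqP <- _; exact: max_card.
Qed.

Lemma leq_kappa3P (G : sgraph) (m : nat) : 2 < #|G| ->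
  (m <= kappa3 G <-> forall S : {set G}, #|S| = 3 -> m <= kappa S).
Proof.
case/kappa3_min=> S S3 [-> minS]; split=> [mS T T3|]; last exact.
exact: leq_trans mS (minS T T3).
Qed.

Lemma tree_edge (G : sgraph) (H : presubgraph G) (x y : G) :
  is_tree H -> x \in H.1 -> y \in H.1 -> x != y ->
  exists2 z, [set x; z] \in H.2 & adj x z.
Proof.
case/and3P=> /andP[/subsetP sH _] /andP[_ /forall_inP cH] _ xH yH.
case/forall_inP/(_ y yH)/connectP: (cH x xH) => -[|z p] /=.
  by move=> _ ->; rewrite eqxx.
by case/andP=> xz _ _ _; exists z => //; rewrite -mem_edges sH.
Qed.

Lemma disjoint_treesP (G : sgraph) (S : {set G}) (F : {set presubgraph G}) :
  reflect ({in F, forall H : presubgraph G, is_tree H /\ S \subset H.1} /\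
    {in F &, forall H H' : presubgraph G, H != H' -> [disjoint H.2 & H'.2] /\ H.1 :&: H'.1 = S})
  (internally_disjoint_trees S F).
Proof.
apply: (iffP andP) => -[F1 F2]; split.
- by move=> H HF; apply/andP; move/forall_inP: F1; apply.
- move=> H H' HF HF' neq; move/forall_inP/(_ H HF)/forall_inP/(_ H' HF'): F2.
  by rewrite neq /= => /andP[-> /eqP ->].
- by apply/forall_inP => H HF; apply/andP; apply: F1.
- apply/forall_inP => H HF; apply/forall_inP => H' HF'; apply/implyP => neq.
  by have [-> ->] := F2 H H' HF HF' neq; rewrite eqxx.
Qed.

(** [S] has a second vertex, so every tree has an edge at [x]; by edge-disjointness, [f] picks
    different neighbours for different trees. *)
Lemma kappa_le_deg (G : sgraph) (S : {set G}) (x : G) :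
  x \in S -> 1 < #|S| -> kappa S <= #|nbhd x|.
Proof.
move=> xS S_gt1; apply/bigmax_leqP => F /disjoint_treesP[treeF disF].
have [y yS yx] : exists2 y, y \in S & y != x.
  move: S_gt1; rewrite (cardsD1 x) xS => /card_gt0P[y].
  by rewrite !inE => /andP[? ?]; exists y.
pose f (H : presubgraph G) := odflt x [pick z | ([set x; z] \in H.2) && adj x z].
have fP H : H \in F -> ([set x; f H] \in H.2) && adj x (f H).
  move=> HF; rewrite /f; case: pickP => [z //|noz].
  have [tH /subsetP SH] := treeF H HF.
  have [|z zH xz] := tree_edge tH (SH x xS) (SH y yS); first by rewrite eq_sym.
  by have := noz z; rewrite zH xz.
rewrite -(@card_in_imset _ _ f) => [|H H' HF HF' eqf].
  by apply/subset_leq_card/subsetP => _ /imsetP[H HF ->]; rewrite inE; case/andP: (fP H HF).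
apply/eqP/negPn/negP => neq; have [/disjoint_setI0 d _] := disF H H' HF HF' neq.
have /andP[e _] := fP H HF; have /andP[e' _] := fP H' HF'.
by have := in_set0 [set x; f H]; rewrite -d inE e eqf e'.
Qed.

Lemma kappa3_le_deg (G : sgraph) (x : G) : 2 < #|G| -> kappa3 G <= #|nbhd x|.
Proof.
move=> G_gt2.
have : 0 < #|[set A : {set G} | A \subset ~: [set x] & #|A| == 2]|.
  by rewrite cards_draws bin_gt0 cardsCs setCK cards1; lia.
case/card_gt0P=> A; rewrite inE => /andP[/subsetP xA /eqP A2].
have xNA : x \notin A by apply/negP => /xA; rewrite !inE eqxx.
have S3 : #|x |: A| = 3 by rewrite cardsU1 xNA A2.
apply: leq_trans ((leq_kappa3P _ G_gt2).1 (leqnn _) _ S3) _.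
by apply: kappa_le_deg (setU11 x A) _; rewrite S3.
Qed.

Section TwoTrees.

Variables (G : sgraph) (S : {set G}) (H1 H2 : presubgraph G).
Hypotheses (tree1 : is_tree H1) (tree2 : is_tree H2).
Hypotheses (SH1 : S \subset H1.1) (SH2 : S \subset H2.1).
Hypothesis (disH : [disjoint H1.2 & H2.2]).

(** Both trees need an edge at [x] to reach [y], the two edges differ, and degree at most 2 leaves
    no third one. *)
Lemma deg2_tree_edges (x y : G) :
  x \in S -> y \in S -> x != y -> #|nbhd x| <= 2 ->
  exists y1 y2, nbhd x = [set y1; y2] /\
   forall z, ([set x; z] \in H1.2 -> z = y1) /\ ([set x; z] \in H2.2 -> z = y2).
Proof.
move=> xS yS xy deg2.
have dis A : A \in H1.2 -> A \in H2.2 -> False.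
  by move=> A1 A2; have := disjointFr disH A1; rewrite A2.
have [y1 e1 a1] := tree_edge tree1 (subsetP SH1 x xS) (subsetP SH1 y yS) xy.
have [y2 e2 a2] := tree_edge tree2 (subsetP SH2 x xS) (subsetP SH2 y yS) xy.
have y12 : y1 != y2 by apply/eqP => eqy; apply: (dis [set x; y1]); rewrite // eqy.
have nx : nbhd x = [set y1; y2].
  apply/eqP; rewrite eq_sym eqEcard cards2 y12 deg2 andbT.
  by apply/subsetP => z /set2P[] ->; rewrite inE.
exists y1, y2; split=> // z.
have sub H : is_tree H -> [set x; z] \in H.2 -> z \in [set y1; y2].
  by case/and3P=> /andP[/subsetP sH _] _ _ /sH; rewrite mem_edges -nx inE.
split=> xz.
  have := sub _ tree1 xz => /set2P[] // eqz; case: (dis [set x; z]) => //.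
  by rewrite eqz.
have := sub _ tree2 xz => /set2P[] // eqz; case: (dis [set x; z]) => //.
by rewrite eqz.
Qed.

End TwoTrees.

(* An edge between two vertices of degree 2 is isolated in whichever of the two
   trees contains it, so that tree cannot reach a third vertex. *)
Lemma deg2_independent (G : sgraph) : 2 <= kappa3 G ->
  independent [set x : G | #|nbhd x| <= 2].
Proof.
move=> k3 u v; rewrite !inE => du dv; apply/negP => uv.
have G_gt2 : 2 < #|G| by apply: kappa3_gt0; apply: leq_trans k3.
have neuv := adj_neq uv.
have [w] : exists w, w \in ~: [set u; v].
  by apply/card_gt0P; rewrite cardsCs setCK cards2 neuv subn_gt0.
rewrite !inE negb_or => /andP[wu wv].
pose S := [set u; v; w].
have S3 : #|S| = 3.
  rewrite /S setUC cardsU1 cards2 neuv !inE negb_or wu wv //.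
have [F /disjoint_treesP[treeF disF] /card_gt1P[H1 [H2 [F1 F2 neqH]]]] :=
  @leq_kappa _ _ 2 isT ((leq_kappa3P 2 G_gt2).1 k3 S S3).
have uS : u \in S by rewrite !inE eqxx.
have vS : v \in S by rewrite !inE eqxx orbT.
have wS : w \in S by rewrite !inE eqxx orbT.
(* By symmetry, [H] may be taken to be the tree whose only edge at [u] leads to [v]. *)
suff main H H' : H \in F -> H' \in F -> H != H' ->
    forall y1 y2, nbhd u = [set y1; y2] ->
    (forall z, [set u; z] \in H.2 -> z = y1) -> y1 = v -> False.
  have [t1 s1] := treeF H1 F1; have [t2 s2] := treeF H2 F2.
  have [dis _] := disF H1 H2 F1 F2 neqH.
  have [y1 [y2 [nu ey]]] := deg2_tree_edges t1 t2 s1 s2 dis uS vS neuv du.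
  have : v \in nbhd u by rewrite inE.
  rewrite nu => /set2P[] eqv.
    by apply: (main H1 H2 F1 F2 neqH y1 y2) => // z; case: (ey z).
  apply: (main H2 H1 F2 F1 _ y2 y1) => //; first by rewrite eq_sym.
    by rewrite nu setUC.
  by move=> z; case: (ey z).
move=> HF HF' neq y1 y2 nu ey eqv; subst y1.
have [t1 s1] := treeF H HF; have [t2 s2] := treeF H' HF'.
have [dis _] := disF H H' HF HF' neq.
have uvH : [set u; v] \in H.2.
  have [z uz _] := tree_edge t1 (subsetP s1 u uS) (subsetP s1 v vS) neuv.
  by rewrite -(ey z uz).
have [|y1 [y3 [nv ev]]] := deg2_tree_edges t1 t2 s1 s2 dis vS uS _ dv.
  by rewrite eq_sym.
have eqy1 : u = y1 by have [e _] := ev u; apply: e; rewrite setUC.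
(* [H] has no other edge at [u] or [v], so it cannot leave this pair to reach [w]. *)
have clos : closed (sub_adj H) (mem [set u; v]).
  apply: intro_closed => [|x y].
    by apply: sym_connect_sym => x y; rewrite /sub_adj /= setUC.
  move=> xy /set2P[] eqx; subst x; first by rewrite (ey y xy) set22.
  by have [e _] := ev y; rewrite (e xy) -eqy1 set21.
have /and3P[_ /andP[_ /forall_inP cH] _] := t1.
move/forall_inP: (cH u (subsetP s1 u uS)) => /(_ w (subsetP s1 w wS)) uw.
have := closed_connect clos uw; rewrite !inE eqxx.
by rewrite (negPf wu) (negPf wv).
Qed.

Lemma size_lower (G : sgraph) : 2 <= kappa3 G -> 6 * #|G| <= 5 * #|edges G|.
Proof.
move=> k3; have G_gt2 : 2 < #|G| by apply: kappa3_gt0; apply: leq_trans k3.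
pose X := [set x : G | #|nbhd x| <= 2].
have deg_ge2 (x : G) : 2 <= #|nbhd x|.
  exact: leq_trans k3 (kappa3_le_deg x G_gt2).
have := sum_deg_independent (deg2_independent k3); rewrite -/X => leX.
have leX2 : 2 * #|X| <= #|edges G|.
  rewrite mulnC -sum_nat_const (leq_trans _ (leq_trans leX _)) //.
    exact: leq_sum.
  by apply/subset_leq_card/subsetP => A; rewrite inE => /andP[].
(* Every degree is at least 2, and at least 3 outside [X]. *)
have : 3 * #|G| <= 2 * #|edges G| + #|X|.
  apply: leq_trans (leq_add (sum_deg_le G) (leqnn _)).
  rewrite -[#|X|]sum1_card [\sum_(x in X) _]big_mkcond -big_split mulnC -sum_nat_const /=.
  by apply: leq_sum => x _; rewrite inE; have := deg_ge2 x; case: (leqP #|nbhd x| 2) => /=; lia.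
lia.
Qed.

(** * Packing two trees *)

Lemma connect_ind (T : finType) (e : rel T) (P : T -> Prop) (x y : T) :
  (forall u v, P u -> e u v -> P v) -> P x -> connect e x y -> P y.
Proof.
move=> Pe + /connectP[p pP ->]; elim: p x pP => //= z p IHp x /andP[xz zp] Px.
by apply: IHp zp _; apply: Pe xz.
Qed.

(* A minimal edge set connecting [V] has no cycle: the other edges of a cycle
   still join the endpoints of any one of its edges. *)
Lemma spanning_tree (G : sgraph) (V : {set G}) (E : {set {set G}}) :
  is_subgraph ((V, E) : presubgraph G) ->
  sub_connected ((V, E) : presubgraph G) ->
  exists2 T : {set {set G}}, T \subset E & is_tree ((V, T) : presubgraph G).
Proof.
move=> subE conE.
pose conn (A : {set {set G}}) := sub_connected ((V, A) : presubgraph G).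
have [T /minsetP[conT minT] sTE] := @minset_exists _ conn E conE.
exists T => //; case/andP: subE => /= sE /forall_inP vE; apply/and3P; split=> //.
  apply/andP; split; first exact: subset_trans sTE sE.
  by apply/forall_inP => A /(subsetP sTE); apply: vE.
apply/sub_acyclicP => -[|x [|y [|z c]]] //= _ /andP[/= /and3P[xy yz zc] uc].
have [neq_xy neq_xz ync] : [/\ x != y, x != z & y \notin z :: c].
  case/andP: uc => xN /andP[-> _]; split=> //; apply: contraNneq xN => ->;
  by rewrite !inE eqxx ?orbT.
pose T' := T :\ [set x; y].
have T'P a b : [set a; b] \in T -> [set a; b] != [set x; y] ->
    sub_adj ((V, T') : presubgraph G) a b.
  by rewrite /sub_adj /= in_setD1 => -> ->.
have conT' : conn T'.
  case/andP: conT => V0 /forall_inP conT; apply/andP; split=> //.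
  apply/forall_inP => a aV; apply/forall_inP => b bV.
  move/forall_inP/(_ b bV): (conT a aV) => /=.
  have symT' : connect_sym (sub_adj ((V, T') : presubgraph G)).
    by apply: sym_connect_sym => u v; rewrite /sub_adj /= setUC.
  (* The long way round the cycle: from [y] to [z], then back to [x] along a path that avoids [y]
     and hence the deleted edge. *)
  have yx : connect (sub_adj ((V, T') : presubgraph G)) y x.
    apply: (@connect_trans _ _ z).
      apply/connect1/T'P => //; apply/eqP => /set2_eq[[/esym/eqP]|[_ /esym/eqP]].
        by rewrite (negPf neq_xy).
      by rewrite (negPf neq_xz).
    apply/connectP; exists (rcons c x); last by rewrite last_rcons.
    apply: (@sub_in_path _ (predC1 y)) zc => [u v|].
      rewrite !inE => uy vy uv; apply: T'P => //; apply/eqP => e.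
      by have := set22 x y; rewrite -e !inE ![y == _]eq_sym (negPf uy) (negPf vy).
    rewrite /= all_rcons /= neq_xy /=; move: ync.
    rewrite inE negb_or eq_sym => /andP[-> yc] /=.
    by apply/allP => u uc'; apply: contraNneq yc => <-.
  apply: connect_sub => u v uv.
  have [/set2_eq[[-> ->]|[-> ->]]|neq] := eqVneq [set u; v] [set x; y].
  - by rewrite symT'.
  - exact: yx.
  - exact/connect1/T'P.
have eT := minT T' conT' (subsetDl _ _).
by have := setD11 [set x; y] T; rewrite -/T' eT; move: xy; rewrite /sub_adj /= => ->.
Qed.

(* Two edge-disjoint subgraphs connecting [S] and meeting only in [S], given by
   their adjacency relations; spanning trees of the components containing [S]
   are then internally disjoint. *)
Definition two_packed (G : sgraph) (S : {set G}) : Prop :=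
  exists e : bool -> rel G,
    [/\ forall b, symmetric (e b), forall b, subrel (e b) (@adj G),
        forall x y, e true x y -> e false x y -> False,
        forall x y z, x \notin S -> e true x y -> e false x z -> False
      & forall b, {in S &, forall x y, connect (e b) x y}].

Lemma two_packed_kappa (G : sgraph) (S : {set G}) :
  1 < #|S| -> two_packed S -> 2 <= kappa S.
Proof.
move=> S_gt1 [e [symE subE disE nonS conE]].
have [s sS] : exists s, s \in S by apply/card_gt0P; lia.
pose V b := [set x | connect (e b) s x].
pose E b : {set {set G}} :=
  [set A in edges G | [exists x in V b, exists y in V b, e b x y && (A == [set x; y])]].
have EP b x y : x \in V b -> e b x y -> [set x; y] \in E b.
  move=> xV xy; rewrite inE mem_edges (subE _ _ _ xy); apply/exists_inP.
  exists x => //; apply/exists_inP; exists y; last by rewrite xy eqxx.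
  by rewrite inE (connect_trans _ (connect1 xy)) //; move: xV; rewrite inE.
have SV b : S \subset V b by apply/subsetP => x xS; rewrite inE conE.
have tr b : exists2 T : {set {set G}}, T \subset E b & is_tree ((V b, T) : presubgraph G).
  apply: spanning_tree; apply/andP; split => /=.
  - by apply/subsetP => A; rewrite inE => /andP[].
  - apply/forall_inP => A; rewrite inE => /andP[_ /exists_inP[x xV /exists_inP[y yV]]].
    by move=> /andP[_ /eqP ->]; apply/subsetP => z /set2P[] ->.
  - by apply/set0Pn; exists s; rewrite inE connect0.
  - have sE x : x \in V b -> connect (sub_adj ((V b, E b) : presubgraph G)) s x.
      rewrite inE; pose P u :=
        connect (e b) s u /\ connect (sub_adj ((V b, E b) : presubgraph G)) s u.
      move=> sx; suff: P x by case.
      apply: (connect_ind _ _ sx) => [u v [su su'] uv|]; last by split; apply: connect0.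
      split; first exact: connect_trans su (connect1 uv).
      by apply: connect_trans su' (connect1 _); apply: EP => //; rewrite inE.
    apply/forall_inP => x xV; apply/forall_inP => y yV.
    have symE' : connect_sym (sub_adj ((V b, E b) : presubgraph G)).
      by apply: sym_connect_sym => u v; rewrite /sub_adj /= setUC.
    by apply: connect_trans (sE y yV); rewrite symE' sE.
have [T1 sT1 tree1] := tr true; have [T2 sT2 tree2] := tr false.
have EE b x y : [set x; y] \in E b -> e b x y.
  rewrite inE => /andP[_ /exists_inP[u _ /exists_inP[v _ /andP[uv /eqP]]]].
  by move=> /set2_eq[[-> ->]|[-> ->]] //; rewrite symE.
have disT : [disjoint T1 & T2].
  apply/pred0P => A /=; apply/negP => /andP[A1 A2].
  have /(subsetP sT2) := A2; have := subsetP sT1 A A1 => A1' A2'.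
  have /edgesP[x [y [_ eA]]] : A \in edges G by move: A1'; rewrite inE => /andP[].
  by subst A; apply: disE (EE _ _ _ A1') (EE _ _ _ A2').
(* A vertex of a component other than [s] has an edge of that colour; this lets [nonS] forbid common
   vertices outside [S]. *)
have leave b x : x \in V b -> x \notin S -> exists z, e b x z.
  rewrite inE => sx xS; have neq : x != s by apply: contraNneq xS => ->.
  move: sx; rewrite (sym_connect_sym (symE b)) => /connectP[[|z p] /=].
    by move=> _ eqs; rewrite eqs eqxx in neq.
  by case/andP => xz _ _; exists z.
pose H1 : presubgraph G := (V true, T1); pose H2 : presubgraph G := (V false, T2).
have VV : V true :&: V false = S.
  apply/eqP; rewrite eqEsubset subsetI !SV /= andbT; apply/subsetP => x /setIP[x1 x2].
  apply/negPn/negP => xS; have [y xy] := leave _ _ x1 xS; have [z xz] := leave _ _ x2 xS.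
  exact: nonS xS xy xz.
(* The family is a set, so the trees must differ: equal ones would share an edge. *)
have neqH : H1 != H2.
  apply/eqP => -[eqV eqT].
  have [t tS ts] : exists2 t, t \in S & t != s.
    move: S_gt1; rewrite (cardsD1 s) sS => /card_gt0P[t].
    by rewrite !inE => /andP[? ?]; exists t.
  have [z sz _] := tree_edge tree1 (subsetP (SV _) t tS) (subsetP (SV _) s sS) ts.
  by have := disjointFr disT sz; rewrite -eqT sz.
have okF : internally_disjoint_trees S [set H1; H2].
  apply/disjoint_treesP; split=> [H|H H'].
    by move=> /set2P[] ->; split; rewrite // SV.
  move=> /set2P[] -> /set2P[] ->; rewrite ?eqxx // => _; split=> //=.
    by rewrite disjoint_sym.
  by rewrite setIC.
rewrite /kappa (leq_trans _ (leq_bigmax_cond _ okF)) //.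
by rewrite cards2 neqH.
Qed.

Lemma kappa3_eq2 (G : sgraph) :
  3 < #|G| -> 5 * #|edges G| <= 6 * #|G| + 4 ->
  (forall S : {set G}, #|S| = 3 -> two_packed S) -> kappa3 G = 2.
Proof.
move=> G_gt3 leE packed; have G_gt2 := ltnW G_gt3.
apply/eqP; rewrite eqn_leq andbC; apply/andP; split.
  by apply/(leq_kappa3P 2 G_gt2) => S S3; apply: two_packed_kappa (packed S S3); rewrite S3.
(* With all degrees at least 3, 3n <= 2e gives 15n <= 12n + 8, so n <= 2. *)
have [x deg_x] : exists x : G, #|nbhd x| <= 2.
  apply/existsP; rewrite -[X in is_true X]negbK negb_exists; apply/negP => /forallP deg3.
  have := sum_deg_le G.
  have : #|G| * 3 <= \sum_(x : G) #|nbhd x|.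
    by rewrite -sum_nat_const; apply: leq_sum => x _; have := deg3 x; rewrite -ltnNge.
  lia.
exact: leq_trans (kappa3_le_deg x G_gt2) deg_x.
Qed.

(** * Suppressing vertices of degree 2 *)

Section Suppress.

Variables (G : sgraph) (D : {set G}).

Definition suppress_adj : rel {x : G | x \notin D} :=
  [rel x y | (x != y) && (adj (val x) (val y) ||
                         [exists d in D, adj (val x) d && adj d (val y)])].

Lemma suppress_adj_sym : symmetric suppress_adj.
Proof.
move=> x y; rewrite /suppress_adj /= eq_sym adj_sym; congr (_ && (_ || _)).
apply: eq_existsb => d; congr (_ && _).
by rewrite andbC adj_sym [adj d _]adj_sym.
Qed.

Lemma suppress_adj_irr : irreflexive suppress_adj.
Proof. by move=> x; rewrite /suppress_adj /= eqxx. Qed.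

Definition suppress : sgraph := SGraph suppress_adj_sym suppress_adj_irr.

Hypothesis indD : independent D.

(** Each vertex of [D] takes two edges away and contributes at most one; independence keeps the lost
    edges of different vertices distinct. *)
Lemma card_edges_suppress :
  {in D, forall d, #|nbhd d| = 2} -> #|edges suppress| + #|D| <= #|edges G|.
Proof.
move=> deg2.
pose E0 := [set A in edges G | [disjoint A & D]].
have E0_le : #|E0| + 2 * #|D| <= #|edges G|.
  rewrite -(cardsID [set A : {set G} | [disjoint A & D]] (edges G)).
  apply: leq_add.
    by apply/subset_leq_card/subsetP => A; rewrite !inE.
  rewrite mulnC -sum_nat_const -(eq_bigr _ deg2).
  apply: leq_trans (sum_deg_independent indD) _.
  by apply/subset_leq_card/subsetP => A; rewrite !inE andbC.
suff : #|edges suppress| <= #|E0| + #|D| by lia.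
have imset_val_inj : injective (fun A : {set suppress} => val @: A).
  by apply: imset_inj; apply: val_inj.
rewrite -(card_imset _ imset_val_inj).
(* Seen in [G], a new edge is the neighbourhood of the suppressed vertex that it replaces. *)
apply: (leq_trans _ (leq_add (leqnn _) (leq_imset_card (@nbhd G) D))).
have := (leq_card_setU E0 [set nbhd d | d in D]).1; apply: leq_trans.
apply/subset_leq_card/subsetP.
move=> _ /imsetP[_ /edgesP[x [y [/andP[neq xy] ->]]] ->].
rewrite imsetU !imset_set1 inE.
have {}neq : val x != val y by [].
case/orP: xy => [xy|/exists_inP[d dD /andP[xd dy]]].
  rewrite inE mem_edges xy disjoint_subset.
  apply/orP; left; apply/subsetP => z /set2P[] ->; rewrite inE;
    [exact: (valP x) | exact: (valP y)].
apply/orP; right; apply/imsetP; exists d => //.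
apply/eqP; rewrite eqEcard deg2 // cards2 neq andbT.
by apply/subsetP => z /set2P[] ->; rewrite inE // adj_sym.
Qed.

Hypothesis no_shortcut : forall x y d, d \in D ->
  adj x d -> adj d y -> ~~ adj x y.
Hypothesis no_twins : forall x y d d', d \in D -> d' \in D -> x != y ->
  adj x d -> adj d y -> adj x d' -> adj d' y -> d = d'.

(** A new edge gets colour [b] when both its halves have it. By [no_shortcut] and [no_twins] each
    edge of [suppress] arises in only one way, so it gets at most one colour. *)
Lemma two_packed_suppress (S : {set suppress}) :
  two_packed (val @: S : {set G}) -> two_packed S.
Proof.
case=> e [symE subE disE nonS conE].
pose f b : rel suppress := [rel x y | (x != y) && (e b (val x) (val y) ||
   [exists d in D, e b (val x) d && e b d (val y)])].
have fP b x y : f b x y -> x != y /\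
    (e b (val x) (val y) \/ exists2 d, d \in D & e b (val x) d /\ e b d (val y)).
  case/andP=> -> /orP[|/exists_inP[d dD /andP[? ?]]]; first by split; auto.
  by split=> //; right; exists d.
exists f; split.
- move=> b x y; rewrite /f /= eq_sym symE; congr (_ && (_ || _)).
  apply: eq_existsb => d; congr (_ && _).
  by rewrite andbC symE [e b d _]symE.
- move=> b x y /andP[neq xy]; apply/andP; split=> //; apply/orP.
  case/orP: xy => [/subE|/exists_inP[d dD /andP[xd dy]]]; [by left|right].
  by apply/exists_inP; exists d; rewrite ?(subE _ _ _ xd) ?(subE _ _ _ dy).
- move=> x y /fP[neq xy] /fP[_ xy'].
  have {}neq : val x != val y by [].
  case: xy xy' => [xy|[d dD [xd dy]]] [xy'|[d' dD' [xd' dy']]].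
  + exact: disE xy xy'.
  + have := no_shortcut dD' (subE _ _ _ xd') (subE _ _ _ dy').
    by rewrite (subE _ _ _ xy).
  + have := no_shortcut dD (subE _ _ _ xd) (subE _ _ _ dy).
    by rewrite (subE _ _ _ xy').
  + have eqd := no_twins dD dD' neq (subE _ _ _ xd) (subE _ _ _ dy)
      (subE _ _ _ xd') (subE _ _ _ dy').
    by subst d'; apply: disE xd xd'.
- have out b x y : f b x y -> exists z, e b (val x) z.
    by case/fP=> _ [xy|[d _ [xd _]]]; [exists (val y)|exists d].
  move=> x y z xS /out[y' xy'] /out[z' xz']; apply: nonS xy' xz'.
  by apply: contra xS => /imsetP[x' x'S /val_inj ->].
- move=> b x y xS yS.
  have exy : connect (e b) (val x) (val y) by apply: conE; apply: imset_f.
  (* The path in [G] may visit [D], where no vertex of [suppress] lies; the invariant then speaks of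
     the surviving neighbours in colour [b]. *)
  pose P (u : G) := (forall u' : suppress, val u' = u -> connect (f b) x u') /\
     (u \in D -> forall w : suppress, e b u (val w) -> connect (f b) x w).
  suff [Py _] : P (val y) by apply: Py.
  apply: (connect_ind _ _ exy) => [u v [Pu Du] uv|].
    split=> [v' eqv|vD w vw].
      subst v; have [uD|uD] := boolP (u \in D); first exact: Du.
      have cu := Pu (exist _ u uD) erefl.
      have [<- //|neq] := eqVneq (exist _ u uD) v'.
      by apply: connect_trans cu (connect1 _); rewrite /f /= neq uv.
    have uD : u \notin D.
      by apply/negP => uD; have := indD uD vD; rewrite (subE _ _ _ uv).
    have cu := Pu (exist _ u uD) erefl.
    have [<- //|neq] := eqVneq (exist _ u uD) w.
    apply: connect_trans cu (connect1 _); rewrite /f /= neq /=.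
    by apply/orP; right; apply/exists_inP; exists v; rewrite // uv.
  by split=> [u' /val_inj -> //|xD]; case/negP: (valP x).
Qed.

End Suppress.

(** * Subdivided Moebius ladders *)

(* In block [i], [inl s] is the end of the rung on rail [s], [inr None] subdivides
   the rung, and [inr (Some s)] subdivides the rail edge leaving [inl s]. *)
Definition mobius_vertex (k : nat) : finType := ('I_k * (bool + option bool))%type.

(* The two rails are exchanged when passing from the last block to block 0. *)
Definition next_corner (k : nat) (i : nat) (s : bool) (j : nat) (t : bool) : bool :=
  (j == i.+1) && (t == s) || [&& i.+1 == k, j == 0 & t == ~~ s].

(** All arcs point from a subdividing vertex to a corner, so the graph is bipartite by
    construction. *)
Definition mobius_arc (k : nat) : rel (mobius_vertex k) :=
  fun u v => match u.2, v.2 with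
  | inr None, inl _ => u.1 == v.1
  | inr (Some s), inl t =>
      (u.1 == v.1) && (s == t) || next_corner k u.1 s v.1 t
  | _, _ => false
  end.

Definition mobius_adj (k : nat) : rel (mobius_vertex k) :=
  [rel u v | mobius_arc u v || mobius_arc v u].

Lemma mobius_adj_sym (k : nat) : symmetric (@mobius_adj k).
Proof. by move=> u v; rewrite /mobius_adj /= orbC. Qed.

Lemma mobius_adj_irr (k : nat) : irreflexive (@mobius_adj k).
Proof. by case=> i [s|[s|]]. Qed.

Definition mobius (k : nat) : sgraph :=
  SGraph (@mobius_adj_sym k) (@mobius_adj_irr k).

Lemma card_mobius (k : nat) : #|mobius k| = 5 * k.
Proof. by rewrite card_prod card_sum card_option card_bool card_ord mulnC. Qed.

(** * Inserting a block into a ladder *)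

Section InsertRung.

Variables (m : nat) (i : 'I_m.+2).

Let lft (u : mobius m.+1) : mobius m.+2 := (lift i u.1, u.2).

(** [before s] and [after s] are the ends of the rail edge that rail [s] of the new block
    subdivides. The negations occur when the new block is first or last, where this edge crosses the
    exchange of rails. *)
Let before (s : bool) : mobius m.+1 :=
  if nat_of_ord i is i'.+1 then (inord i', inr (Some s)) else (ord_max, inr (Some (~~ s))).

Let after (s : bool) : mobius m.+1 :=
  if i == m.+1 :> nat then (ord0, inl (~~ s)) else (inord i, inl s).

Let corner (s : bool) : mobius m.+2 := (i, inl s).
Let middle (s : bool) : mobius m.+2 := (i, inr (Some s)).

Lemma lft_inj : injective lft.
Proof. by move=> [a x] [b y] [e ->]; congr (_, _); exact/(@lift_inj _ i)/val_inj. Qed.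

Lemma lft_neq u x : lft u <> (i, x).
Proof. by case=> /eqP; rewrite eq_sym (negPf (neq_lift i _)). Qed.

Lemma adj_before s : adj (lft (before s)) (corner s).
Proof.
apply/orP; left; rewrite /lft /before /mobius_arc /next_corner.
have lti := ltn_ord i; case ei: (nat_of_ord i) lti => [|i'] /= lti; apply/orP; right.
  by rewrite /bump ei add1n negbK !eqxx.
by rewrite inordK // /bump ei ltnn add0n !eqxx.
Qed.

Lemma adj_corner s : adj (corner s) (middle s).
Proof. by apply/orP; right; rewrite /mobius_arc /= !eqxx. Qed.

Lemma adj_after s : adj (middle s) (lft (after s)).
Proof.
apply/orP; left; rewrite /lft /after /mobius_arc /next_corner.
have lti := ltn_ord i; case: eqP => [e|ne] /=; apply/orP; right.
  by rewrite e /bump /= !eqxx.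
have lti' : i < m.+1 by lia.
by rewrite inordK // /bump leqnn add1n !eqxx.
Qed.

(** The new block breaks only the two rail edges running past its place; all other edges lift. *)
Lemma lft_arc u v : mobius_arc u v ->
  mobius_arc (lft u) (lft v) \/ exists s, u = before s /\ v = after s.
Proof.
case: u v => [a x] [b y]; rewrite /mobius_arc /lft /=.
case: x y => [//|[s|]] [t|] //=; last by move/eqP->; rewrite eqxx; left.
have lti := ltn_ord i; have lta := ltn_ord a; have ltb := ltn_ord b.
case/orP=> [/andP[/eqP -> ->]|]; first by rewrite eqxx; left.
case/orP=> [/andP[/eqP eb /eqP ->]|/and3P[/eqP ea /eqP eb /eqP ->]].
  have [ei|nei] := eqVneq (nat_of_ord i) a.+1.
    right; exists s; rewrite /before /after ei; split.
      by congr (_, _); apply: val_inj; rewrite /= inordK.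
    rewrite ifN; last by apply/eqP; lia.
    by congr (_, _); apply: val_inj; rewrite /= inordK; lia.
  left; apply/orP; right; rewrite /next_corner /= /bump eqxx ?andbT.
  by apply/orP; left; apply/eqP; lia.
(* For an edge crossing the exchange of rails: a new first block lies after the exchange, a new last
   block before it, hence the labels [~~ s] and [s]. *)
have [ei|nei0] := eqVneq (nat_of_ord i) 0.
  right; exists (~~ s); rewrite /before /after ei negbK; split.
    by congr (_, _); apply: val_inj => /=; lia.
  by congr (_, _); apply: val_inj; rewrite /= inordK; lia.
have [ei|nei] := eqVneq (nat_of_ord i) m.+1.
  right; exists s; rewrite /before /after ei eqxx; split.
    by congr (_, _); apply: val_inj; rewrite /= inordK; lia.
  by congr (_, _); apply: val_inj => /=; lia.
left; apply/orP; right; rewrite /next_corner /= /bump eqxx ?andbT.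
by apply/orP; right; apply/andP; split; apply/eqP; lia.
Qed.

Definition link (s : bool) : rel (mobius m.+2) := fun u v =>
  (u, v) \in [:: (lft (before s), corner s); (corner s, middle s); (middle s, lft (after s))].

(* Without its rung, block [i] only subdivides the edges [before s]-[after s] of
   the smaller ladder: [corner s] and [middle s] inherit the colour of that edge. *)
Lemma two_packed_insert_rung (S : {set mobius m.+2}) :
  (forall x, (i, x) \notin S) -> two_packed (lft @^-1: S) -> two_packed S.
Proof.
move=> Si [e [symE subE disE nonS conE]].
(* The conjunct [adj u v] drops the lifts of the two broken edges; the links replace them. *)
pose f b : rel (mobius m.+2) := fun u v => 
  adj u v && [exists p : mobius m.+1 * mobius m.+1,
                ((u, v) == (lft p.1, lft p.2)) && e b p.1 p.2] ||
  [exists s, e b (before s) (after s) && (link s u v || link s v u)].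
have linkP s u v : reflect [\/ u = lft (before s) /\ v = corner s, u = corner s /\ v = middle s
     | u = middle s /\ v = lft (after s)] (link s u v).
  rewrite /link !inE; apply: (iffP or3P) => [[]/eqP[-> ->]|[][-> ->]]; rewrite ?eqxx.
  - by constructor 1.
  - by constructor 2.
  - by constructor 3.
  - by constructor 1.
  - by constructor 2.
  - by constructor 3.
have fP b u v : f b u v -> adj u v /\
    ((exists u' v', [/\ u = lft u', v = lft v' & e b u' v']) \/
     exists s, e b (before s) (after s) /\ (link s u v \/ link s v u)).
  case/orP=> [/andP[uv /existsP[[u' v'] /=]]|/existsP[s /andP[es /orP l]]].
    rewrite xpair_eqE -andbA => /and3P[/eqP eu /eqP ev e']; split=> //.
    by left; exists u', v'.
  split; last by right; exists s.
  have adj_link a c : link s a c -> adj a c.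
    case/linkP=> -[-> ->]; [exact: adj_before|exact: adj_corner|exact: adj_after].
  by case: l => /adj_link //; rewrite adj_sym.
have f_lft b u v : f b (lft u) v -> exists w, e b u w.
  case/fP=> _ [[u' [v' [/lft_inj -> _ e']]]|[s [es]]]; first by exists v'.
  case=> /linkP[] [].
  - by move/lft_inj=> -> _; exists (after s).
  - by move/lft_neq.
  - by move/lft_neq.
  - by move=> _ /lft_neq.
  - by move=> _ /lft_neq.
  - by move=> _ /lft_inj->; exists (before s); rewrite symE.
have f_lft2 b u v : f b (lft u) (lft v) -> e b u v.
  case/fP=> _ [[u' [v' [/lft_inj -> /lft_inj ->]]] //|[s [_]]].
  by case=> /linkP[] [] => [_ /lft_neq|/lft_neq|/lft_neq|_ /lft_neq|/lft_neq|/lft_neq].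
have f_new b u v : u.1 = i -> f b u v ->
    exists2 s, (u = corner s) \/ (u = middle s) & e b (before s) (after s).
  move=> ui /fP[_ [[u' [v' [eu _ _]]]|[s [es l]]]].
    by case: (@lft_neq u' u.2); rewrite -eu -ui; case: (u).
  have out w : u <> lft w by move=> eu; apply: (@lft_neq w u.2); rewrite -eu -ui; case: (u).
  exists s => //; case: l => /linkP[] [].
  - by move/out.
  - by left.
  - by right.
  - by left.
  - by right.
  - by move=> _ /out.
(* All edges at a new vertex inherit the colour of one broken edge, and [disE] makes that colour
   unique. *)
have f_disj u v z : u.1 = i -> f true u v -> f false u z -> False.
  move=> ui /(f_new _ _ _ ui)[s us e1] /(f_new _ _ _ ui)[t ut e2].
  suff est : s = t by subst t; apply: disE e1 e2.
  by case: us ut => -> [] [].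
have lftP u : u.1 = i \/ exists w, u = lft w.
  case: (unliftP i u.1) => [j uj|]; [right|by left].
  by exists (j, u.2); rewrite /lft /= -uj; case: (u).
have symF b : symmetric (f b).
  move=> u v; rewrite /f adj_sym; congr (_ && _ || _).
    apply/existsP/existsP => -[[x y] /=]; rewrite xpair_eqE => /andP[/andP[xu yv] exy];
    by exists (y, x); rewrite /= xpair_eqE xu yv symE.
  by apply: eq_existsb => s; rewrite orbC.
exists f; split=> //.
- by move=> b u v /fP[].
- move=> u v fu fv; case: (lftP u) => [ui|[u' eu]]; first exact: f_disj ui fu fv.
  case: (lftP v) => [vi|[v' ev]].
    by apply: (f_disj v u u vi); rewrite symF.
  by subst; apply: disE (f_lft2 _ _ _ fu) (f_lft2 _ _ _ fv).
- move=> u v z uS fu fz; case: (lftP u) => [ui|[u' eu]]; first exact: f_disj ui fu fz.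
  subst u; have [v' e1] := f_lft _ _ _ fu; have [z' e2] := f_lft _ _ _ fz.
  by apply: nonS e1 e2; rewrite inE.
- move=> b u v uS vS; have inS w : w \in S -> exists2 w', w = lft w' & w' \in lft @^-1: S.
    move=> wS; case: (lftP w) => [wi|[w' ew]]; last by exists w'; rewrite // inE -ew.
    by have := Si w.2; rewrite -wi; case: (w) wS => a x /= ->.
  have [u' -> u'S] := inS u uS; have [v' -> v'S] := inS v vS.
  pose P x := connect (f b) (lft u') (lft x).
  apply: (@connect_ind _ _ P _ _ _ _ (conE b _ _ u'S v'S)) => [x y ux xy|]; last first.
    exact: connect0.
  apply: connect_trans ux _.
  (* An edge either lifts or becomes a path of three links. *)
  have step x' y' : e b x' y' -> mobius_arc x' y' -> connect (f b) (lft x') (lft y').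
    move=> xy' /lft_arc[arc|[s [ex ey]]].
      apply: connect1; apply/orP; left; apply/andP; split; first by apply/orP; left.
      by apply/existsP; exists (x', y'); rewrite /= eqxx.
    have lk u1 v1 : link s u1 v1 -> connect (f b) u1 v1.
      move=> l; apply: connect1; apply/orP; right; apply/existsP; exists s.
      by rewrite -ex -ey xy' l.
    rewrite ex ey; apply: (@connect_trans _ _ (corner s)); first by apply/lk/linkP; constructor 1.
    apply: (@connect_trans _ _ (middle s)); first by apply/lk/linkP; constructor 2.
    by apply/lk/linkP; constructor 3.
  have /orP[arc|arc] := subE _ _ _ xy; first exact: step.
  by rewrite (sym_connect_sym (symF b)); apply: step; rewrite // symE.
Qed.

End InsertRung.

Lemma two_packed_mobius (k : nat) :
  (forall S : {set mobius 3}, #|S| = 3 -> two_packed S) ->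
  2 < k -> forall S : {set mobius k}, #|S| = 3 -> two_packed S.
Proof.
move=> base; elim: k => // k IHk; rewrite leq_eqVlt => /orP[/eqP <- //|k_gt2] S S3.
case: k IHk k_gt2 S S3 => // m IHm m_gt2 S S3.
have [i] : exists i, i \in ~: [set x.1 | x in S].
  apply/card_gt0P; rewrite cardsCs setCK card_ord subn_gt0.
  by apply: leq_ltn_trans (leq_imset_card _ _) _; rewrite S3.
rewrite inE => iS.
have Si x : (i, x) \notin S.
  by apply: contra iS => xS; apply/imsetP; exists (i, x).
apply: (two_packed_insert_rung Si); apply: IHm => //.
(* As [S] avoids block [i], it is the image of its preimage, which therefore still has three
   vertices. *)
rewrite -S3 -(card_imset _ (@lft_inj m i)); apply: eq_card => x.
apply/imsetP/idP => [[y + ->]|xS]; first by rewrite inE.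
case: (unliftP i x.1) => [j xj|xi]; last by have := Si x.2; rewrite -xi; case: (x) xS => a y /= ->.
by exists (j, x.2); rewrite ?inE /= -xj; case: (x) xS.
Qed.

(** * Degrees and number of edges of the ladders *)

Section MobiusSize.

Variable m : nat.

Let next (i : 'I_m.+1) (s : bool) : mobius m.+1 :=
  if i == m :> nat then (ord0, inl (~~ s)) else (inord i.+1, inl s).

Lemma nbhd_rung (i : 'I_m.+1) :
  @nbhd (mobius m.+1) (i, inr None) = [set (i, inl true); (i, inl false)].
Proof.
apply/setP => -[j [t|t]]; rewrite !inE /= /mobius_adj /mobius_arc /=.
  by rewrite orbF !xpair_eqE eq_sym; case: t; rewrite /= ?andbT ?andbF ?orbF.
by rewrite !xpair_eqE /= !andbF; case: t.
Qed.

Lemma nbhd_middle (i : 'I_m.+1) (s : bool) :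
  @nbhd (mobius m.+1) (i, inr (Some s)) = [set (i, inl s); next i s].
Proof.
have lti := ltn_ord i.
apply/setP => -[j [t|t]]; rewrite !inE /= /mobius_adj /mobius_arc /=; last first.
  by rewrite /next; case: ifP; rewrite !xpair_eqE /= !andbF; case: t.
have ltj := ltn_ord j.
have eq1 (x y : 'I_m.+1) (b c : bool) :
  ((x, inl b) == (y, inl c) :> mobius m.+1) = (x == y :> nat) && (b == c) by [].
rewrite orbF /next /next_corner eqSS -[i == j]/(i == j :> nat).
have [e|ne] := eqVneq (nat_of_ord i) m; rewrite !eq1 ?inordK; try lia.
by case: s t => -[] /=; lia.
Qed.

Lemma card_nbhd_inr (i : 'I_m.+1) (o : option bool) :
  #|@nbhd (mobius m.+1) (i, inr o)| = 2.
Proof.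
have lti := ltn_ord i; case: o => [s|]; last first.
  by rewrite nbhd_rung cards2 (_ : _ != _) //; apply/eqP.
rewrite nbhd_middle cards2 (_ : _ != _) //; apply/eqP; rewrite /next.
case: eqVneq => [_|ne] []; first by case: s.
by move/(congr1 (@nat_of_ord _)); rewrite inordK; lia.
Qed.

Definition subdividers : {set mobius m.+1} :=
  [set (p.1, inr p.2) | p : 'I_m.+1 * option bool].

Lemma mem_subdividers u : (u \in subdividers) = if u.2 is inr _ then true else false.
Proof.
apply/imsetP/idP => [[p _ ->] //|]; case: u => i [//|o] _.
by exists (i, o).
Qed.

Lemma subdividers_adj u v : adj u v -> (u \in subdividers) = (v \notin subdividers).
Proof.
rewrite !mem_subdividers; case: u v => i [s|o] [j [t|o']] //=.
by rewrite /mobius_adj /mobius_arc /=; case: o o' => [?|] [?|].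
Qed.

Lemma independent_subdividers : independent subdividers.
Proof. by move=> u v uX vX; apply/negP => /subdividers_adj; rewrite uX vX. Qed.

(** Each edge has exactly one end among the 3(m + 1) subdividing vertices, all of degree 2. *)
Lemma card_edges_mobius : #|edges (mobius m.+1)| <= 6 * m.+1.
Proof.
have : \sum_(x in subdividers) #|nbhd x| = #|edges (mobius m.+1)|.
  rewrite sum_deg -sum1_card; apply: eq_bigr => A /edgesP[x [y [xy ->]]].
  have xXE := subdividers_adj xy; have [yX|yX] := boolP (y \in subdividers).
    have xX : x \notin subdividers by rewrite xXE yX.
    rewrite (_ : _ :&: _ = [set y]) ?cards1 //; apply/setP => z; rewrite in_setI !inE.
    by have [->|_] := eqVneq z y; [rewrite orbT|rewrite orbF; case: eqVneq => // ->; exact: negPf].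
  have xX : x \in subdividers by rewrite xXE yX.
  rewrite (_ : _ :&: _ = [set x]) ?cards1 //; apply/setP => z; rewrite in_setI !inE.
  by have [->|_] := eqVneq z x => //=; case: eqVneq => // ->; exact: negPf.
move=> <-; apply: (@leq_trans (\sum_(x in subdividers) 2)).
  by apply: leq_sum => _ /imsetP[p _ ->]; rewrite card_nbhd_inr.
pose f (p : 'I_m.+1 * option bool) : mobius m.+1 := (p.1, inr p.2).
rewrite sum_nat_const; have := leq_imset_card f predT.
by rewrite card_prod card_option card_bool card_ord -/subdividers; lia.
Qed.

End MobiusSize.

(** * Ladders with up to four vertices suppressed *)

Lemma exists_subset_card (T : finType) (A : {set T}) (j : nat) :
  j <= #|A| -> exists2 B : {set T}, B \subset A & #|B| = j.
Proof.
rewrite -bin_gt0 -cards_draws => /card_gt0P[B].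
by rewrite inE => /andP[sBA /eqP Bj]; exists B.
Qed.

(** The candidates for suppression are the middles of the rungs and one rail vertex [z]: for k = 3
    the rungs alone do not provide four vertices. *)
Lemma suppressed_mobius (k j : nat) :
  (forall S : {set mobius 3}, #|S| = 3 -> two_packed S) ->
  2 < k -> j <= 4 ->
  exists G : sgraph, [/\ #|G| = 5 * k - j, #|edges G| <= 6 * k - j
    & forall S : {set G}, #|S| = 3 -> two_packed S].
Proof.
move=> base k_gt2 j_le4; case: k k_gt2 => // m m_gt1.
pose z : mobius m.+1 := (ord0, inr (Some false)).
pose Y : {set mobius m.+1} := [set (i, inr None) | i : 'I_m.+1].
have [D sD Dj] : exists2 D : {set mobius m.+1}, D \subset z |: Y & #|D| = j.
  apply: exists_subset_card; rewrite cardsU1 card_imset ?card_ord; last by move=> ? ? [].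
  by case: imsetP => [[? _ []]//|_]; lia.
have DP d : d \in D -> d = z \/ exists i, d = (i, inr None).
  by move/(subsetP sD)/setU1P => [|/imsetP[i _]] ->; [left|right; exists i].
have sDX : D \subset subdividers m.
  by apply/subsetP => d /DP[|[i]] ->; rewrite mem_subdividers.
have indD : independent D.
  by move=> d d' /(subsetP sDX) dX /(subsetP sDX) d'X; apply: independent_subdividers.
have degD : {in D, forall d, #|nbhd d| = 2}.
  by move=> d /(subsetP sDX)/imsetP[p _ ->]; apply: card_nbhd_inr.
exists (suppress D); split.
- by rewrite /= card_sig -Dj -card_mobius -(cardsC D) addKn; apply: eq_card => x; rewrite !inE.
- by have := card_edges_suppress indD degD; have := card_edges_mobius m; lia.
- move=> S S3; apply: two_packed_suppress => //.
  (* Both neighbours of a subdividing vertex are corners, and corners are never adjacent. *)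
  + move=> x y d /(subsetP sDX) dX xd dy; apply/negP => /subdividers_adj.
    by rewrite (subdividers_adj xd) dX -(negbK (y \in _)) -(subdividers_adj dy) dX.
  (* The neighbours of [z] lie in blocks 0 and 1, those of a rung middle in a single block; so [z]
     is no twin of a rung middle. *)
  + have nz u : adj u z -> u = (ord0, inl false) \/ u = (inord 1, inl false).
      rewrite adj_sym => zu; have : u \in nbhd z by rewrite inE.
      by rewrite nbhd_middle; case: eqP => [/= e|_]; [lia|move/set2P].
    have ny u i : adj u ((i, inr None) : mobius m.+1) -> u.1 = i.
      rewrite adj_sym => yu; have : u \in nbhd ((i, inr None) : mobius m.+1) by rewrite inE.
      by rewrite nbhd_rung => /set2P[] ->.
    have yz x y i : x != y -> adj x ((i, inr None) : mobius m.+1) ->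
        adj y ((i, inr None) : mobius m.+1) -> adj x z -> adj y z -> False.
      move=> neq /ny xi /ny yi /nz xz /nz yz'; case/eqP: neq.
      have n01 : ord0 != inord 1 :> 'I_m.+1.
        by apply/eqP => /(congr1 val); rewrite /= inordK //; lia.
      case: xz yz' xi yi => -> [] -> //= ei ei'; move: n01; by rewrite ei -ei' eqxx.
    move=> x y d d' /DP[->|[i ->]] /DP[->|[i' ->]] neq xd;
      rewrite adj_sym => yd xd'; rewrite adj_sym => yd' //.
    * by case: (yz x y i').
    * by case: (yz x y i).
    * by rewrite -(ny _ _ xd) -(ny _ _ xd').
  + by apply: two_packed_mobius => //; rewrite card_imset //; apply: val_inj.
Qed.

(** * Searching for two trees *)

Section Search.

Variables (E : seq (nat * nat)) (m n : nat).

Section Triple.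

Variable T : seq nat.

(* A label [h] on the vertices outside the triple determines all edge colours
   except those of the edges inside the triple, which are given by [g]: the three
   pairs of positions in [T] have index sums 1, 2 and 3. *)
Definition colour (h g : seq bool) (i j : nat) : option bool :=
  if i \in T then
    if j \in T then Some (nth true g (index i T + index j T).-1)
    else Some (nth true h j)
  else if j \in T then Some (nth true h i)
  else if nth true h i == nth true h j then Some (nth true h i) else None.

Definition grow (F : seq (nat * nat)) (X : seq nat) : seq nat :=
  foldl (fun X f =>
    if f.1 \in X then if f.2 \in X then X else f.2 :: X
    else if f.2 \in X then f.1 :: X else X) X F.

Fixpoint saturate (fuel : nat) (F : seq (nat * nat)) (X : seq nat) : seq nat :=
  if fuel is fuel'.+1 then
    let Y := grow F X in
    if size Y == size X then X else saturate fuel' F Y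
  else X.

Definition joined (F : seq (nat * nat)) : bool :=
  all (mem (saturate n F [:: head 0 T])) T.

Definition joins (h g : seq bool) (b : bool) : bool :=
  joined [seq f <- E | colour h g f.1 f.2 == Some b].

Definition neighbours (x : nat) : seq nat :=
  [seq f.2 | f <- E & f.1 == x] ++ [seq f.1 | f <- E & f.2 == x].

(* Only the labels below [m] are searched; vertices from [m] on follow
   their first neighbour outside the triple. *)
Definition extend (h : seq bool) : seq bool :=
  h ++ [seq head true [seq nth true h y | y <- neighbours x & y \notin T]
       | x <- iota m (n - m)].

(** Only positions marked [true] are enumerated. The others, labels inside the triple and colours of
    non-adjacent pairs, are never read and get a dummy [true]. *)
Definition choices (free : seq bool) : seq (seq bool) :=
  foldr (fun b r => if b then [seq true :: l | l <- r] ++ [seq false :: l | l <- r]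
                    else [seq true :: l | l <- r]) [:: [::]] free.

Definition inner_pairs : seq bool :=
  let adj i j := (nth 0 T i, nth 0 T j) \in E ++ [seq (f.2, f.1) | f <- E] in
  [:: adj 0 1; adj 0 2; adj 1 2].

Definition packable : bool :=
  has (fun h => let h' := extend h in
        has (fun g => joins h' g true && joins h' g false) (choices inner_pairs))
      (choices [seq x \notin T | x <- iota 0 m]).

End Triple.

Definition all_packable : bool :=
  all (fun c => all (fun b => all (fun a => packable [:: a; b; c]) (iota 0 b))
                    (iota 0 c)) (iota 0 n).

End Search.

(** * Soundness of the search *)

Lemma colour_sym (T : seq nat) (h g : seq bool) (i j : nat) :
  colour T h g i j = colour T h g j i.
Proof.
rewrite /colour [index j T + _]addnC.
case: (i \in T); case: (j \in T) => //; rewrite eq_sym.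
by case: eqP => // ->.
Qed.

(** [grow] adds only vertices joined to earlier ones, so a property constant along the edges
    spreads; too little fuel could only make the test fail. *)
Lemma mem_saturate (F : seq (nat * nat)) (P : nat -> Prop) (fuel : nat) (X : seq nat) :
  (forall f, f \in F -> P f.1 <-> P f.2) -> {in X, forall i, P i} ->
  {in saturate fuel F X, forall i, P i}.
Proof.
move=> PF; elim: fuel X => //= fuel IH X PX; case: ifP => // _; apply: IH.
rewrite /grow; elim: F PF X PX => //= f F IHF PF X PX.
apply: IHF => [f' f'F|]; first by apply: PF; rewrite inE f'F orbT.
have Pf : P f.1 <-> P f.2 by apply: PF; rewrite inE eqxx.
move=> i; case: ifP => [/PX P1|_]; case: ifP => [/PX P2|_].
- exact: PX.
- by rewrite inE => /predU1P[->|/PX //]; apply/Pf.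
- by rewrite inE => /predU1P[->|/PX //]; apply/Pf.
- exact: PX.
Qed.

Section SearchCorrect.

Variables (G : sgraph) (rank : G -> nat) (E : seq (nat * nat)).
Hypothesis rank_inj : injective rank.
Hypothesis rankE : forall f, f \in E ->
  exists x y, [/\ rank x = f.1, rank y = f.2 & adj x y].

(** Whatever labels the search returns, [colour] gives an edge at most one colour, and all coloured
    edges at a vertex outside [S] carry its own label. *)
Lemma packable_two_packed (m n : nat) (T : seq nat) (S : {set G}) :
  {in T, forall i, exists x, rank x = i} ->
  (forall x, (rank x \in T) = (x \in S)) -> packable E m n T -> two_packed S.
Proof.
move=> Trank TS /hasP[h' _ /hasP[g _]]; set h := extend _ _ _ _ _ => /andP[jt jf].
pose e b : rel G := [rel x y | adj x y && (colour T h g (rank x) (rank y) == Some b)].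
have symE b : symmetric (e b) by move=> x y; rewrite /e /= adj_sym colour_sym.
exists e; split=> //.
- by move=> b x y /andP[].
- by move=> x y /andP[_ /eqP xy] /andP[_]; rewrite xy.
- move=> x y z xS /andP[_ /eqP] + /andP[_ /eqP].
  rewrite /colour !TS (negPf xS); case: (y \in S); case: (z \in S); do ?case: ifP => //; congruence.
- move=> b; have {jt jf} : joins E n T h g b by case: b.
  rewrite /joins /joined; set F := filter _ _ => /allP jn x y xS yS.
  have [t rt] : exists t, rank t = head 0 T.
    apply: Trank; move: (xS); rewrite -TS; case: (T) => [//|i T' _].
    by rewrite inE eqxx.
  have all_t z : z \in S -> connect (e b) t z.
    rewrite -TS => /jn zX; pose P i := forall z, rank z = i -> connect (e b) t z.
    suff /(_ _ zX) Pz : {in saturate n F [:: head 0 T], forall i, P i} by apply: Pz.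
    apply: mem_saturate => [f|i]; last first.
      by rewrite inE => /eqP -> z'; rewrite -rt => /rank_inj ->; apply: connect0.
    rewrite mem_filter => /andP[col /rankE[u [v [ru rv uv]]]].
    have euv : e b u v by rewrite /e /= uv ru rv.
    split=> Pf w.
      rewrite -rv => /rank_inj ->; apply: connect_trans (Pf u ru) (connect1 euv).
    rewrite -ru => /rank_inj ->; apply: connect_trans (Pf v rv) (connect1 _).
    by rewrite symE.
  apply: connect_trans (all_t y yS).
  by rewrite (sym_connect_sym (symE b)) all_t.
Qed.

Lemma all_packable_two_packed (m n : nat) (S : {set G}) :
  (forall x, rank x < n) -> all_packable E m n -> #|S| = 3 -> two_packed S.
Proof.
move=> rank_lt packE S3; pose T := sort leq [seq rank x | x <- enum S].
have TS x : (rank x \in T) = (x \in S).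
  by rewrite mem_sort mem_map // mem_enum.
have : sorted ltn T.
  rewrite ltn_sorted_uniq_leq sort_uniq map_inj_uniq // enum_uniq.
  exact: sort_sorted leq_total _.
have lt_n i : i \in T -> i < n by rewrite mem_sort => /mapP[x _ ->].
have Trank : {in T, forall i, exists x, rank x = i}.
  by move=> i; rewrite mem_sort => /mapP[x _ ->]; exists x.
have : size T = 3 by rewrite size_sort size_map -cardE.
(* Sorted ranks form a triple a < b < c, the shape that [all_packable] enumerates. *)
case: T TS lt_n Trank => [|a [|b [|c [|]]]] //= TS lt_n Trank _ /and3P[ab bc _].
apply: (packable_two_packed Trank TS).
move/allP: packE => /(_ c); rewrite mem_iota lt_n ?inE ?eqxx ?orbT // => /(_ isT).
by move=> /allP/(_ b); rewrite mem_iota bc => /(_ isT) /allP/(_ a); rewrite mem_iota ab; apply.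
Qed.

End SearchCorrect.

(* Numbers the hexagon of the two rails first, then its subdividing vertices, then
   the rungs. *)
Definition mobius3_rank (u : mobius 3) : nat :=
  match u.2 with
  | inl s => 3 * s + u.1
  | inr (Some s) => 6 + 3 * s + u.1
  | inr None => 12 + u.1
  end.

(** Inverse of [mobius3_rank] below 15, with explicit ordinals so that the edge list can be checked
    by evaluation. *)
Definition mobius3_vertex (p : nat) : mobius 3 :=
  let o := nth (@Ordinal 3 0 isT)
    [:: @Ordinal 3 0 isT; @Ordinal 3 1 isT; @Ordinal 3 2 isT] (p %% 3) in
  (o, if p < 6 then inl (3 <= p) else if p < 12 then inr (Some (9 <= p)) else inr None).

Definition mobius3_edges : seq (nat * nat) :=
  flatten [seq [:: (i, 6 + i); (i.+1 %% 6, 6 + i)] | i <- iota 0 6] ++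
  flatten [seq [:: (i, 12 + i); (i + 3, 12 + i)] | i <- iota 0 3].

Lemma two_packed_mobius3 (S : {set mobius 3}) : #|S| = 3 -> two_packed S.
Proof.
(* Of the 15 vertices only the 6 corners are labelled freely; each subdividing vertex follows a
   corner. *)
apply: (@all_packable_two_packed _ mobius3_rank mobius3_edges _ _ 6 15).
- move=> [i x] [j y]; rewrite /mobius3_rank /=.
  have lti := ltn_ord i; have ltj := ltn_ord j.
  case: x y => [s|[s|]] [t|[t|]] /= e; try by exfalso; move: e; try (case: s); try (case: t); lia.
  1,2: have [-> ?] : s = t /\ i = j :> nat by move: e; case: s t => -[]; lia.
  1,2: by congr (_, _); apply: val_inj.
  by congr (_, _); apply: val_inj; rewrite /=; lia.
- have vP : all (fun f => [&& mobius3_rank (mobius3_vertex f.1) == f.1,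
      mobius3_rank (mobius3_vertex f.2) == f.2
    & adj (mobius3_vertex f.1) (mobius3_vertex f.2)]) mobius3_edges by vm_compute.
  move=> f /(allP vP)/and3P[/eqP ? /eqP ? ?].
  by exists (mobius3_vertex f.1), (mobius3_vertex f.2).
- move=> [i x]; rewrite /mobius3_rank /=; have lti := ltn_ord i.
  by case: x => [[]|[[]|]]; lia.
- by vm_cast_no_check (erefl true).
Qed.

(** * Graphs given by edge lists, and the orders 4 to 8 *)

Section ListGraph.

Variables (n : nat) (E : seq (nat * nat)).

Definition list_adj : rel 'I_n :=
  [rel i j : 'I_n | (i != j) && (((i : nat, j : nat) \in E) || ((j : nat, i : nat) \in E))].

Lemma list_adj_sym : symmetric list_adj.
Proof. by move=> i j; rewrite /list_adj /= eq_sym orbC. Qed.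

Lemma list_adj_irr : irreflexive list_adj.
Proof. by move=> i; rewrite /list_adj /= eqxx. Qed.

Definition list_graph : sgraph := SGraph list_adj_sym list_adj_irr.

Lemma card_edges_list_graph : #|edges list_graph| <= size E.
Proof.
pose s := [seq [set x : list_graph | (x == f.1 :> nat) || (x == f.2 :> nat)] | f <- E].
rewrite -(size_map (fun f => [set x : list_graph | (x == f.1 :> nat) || (x == f.2 :> nat)])) -/s.
apply: leq_trans (card_size s); apply/subset_leq_card/subsetP => A /edgesP[x [y [xy ->]]].
have {xy} [xy|xy] : ((x : nat, y : nat) \in E) \/ ((y : nat, x : nat) \in E).
  by case/andP: xy => _ /orP.
  by apply/mapP; exists (x : nat, y : nat) => //; apply/setP => z; rewrite !inE.
by apply/mapP; exists (y : nat, x : nat) => //; apply/setP => z; rewrite !inE orbC.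
Qed.

Lemma two_packed_list_graph (S : {set list_graph}) :
  all (fun f => [&& f.1 < n, f.2 < n & f.1 != f.2]) E ->
  all_packable E n n -> #|S| = 3 -> two_packed S.
Proof.
move=> /allP ltE packE; move: packE.
apply: (@all_packable_two_packed list_graph (@nat_of_ord n) E) => [|f fE|x].
- exact: ord_inj.
- have /and3P[lt1 lt2 neq] := ltE f fE.
  exists (Ordinal lt1), (Ordinal lt2); split=> //.
  by apply/andP; split; rewrite // -surjective_pairing fE.
- exact: ltn_ord.
Qed.

End ListGraph.

Definition cycle_edges (n : nat) : seq (nat * nat) :=
  [seq (i, i.+1 %% n) | i <- iota 0 n].

(* For n >= 6 this is K_4 with n - 4 edges of a 4-cycle subdivided, so that no
   triangle is fully subdivided; for n = 4 and n = 5 it is K_4 minus an edge and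
   K_{2,3}. *)
Definition small_edges (n : nat) : seq (nat * nat) :=
  match n with
  | 4 => (0, 2) :: cycle_edges 4
  | 5 => [:: (0, 4), (4, 2) & cycle_edges 4]
  | 6 => [:: (0, 3), (2, 5) & cycle_edges 6]
  | _ => [:: (0, 4), (2, 6) & cycle_edges n]
  end.

Lemma small_graph (n : nat) : 4 <= n <= 8 ->
  exists G : sgraph, [/\ #|G| = n, 5 * #|edges G| <= 6 * n + 4
    & forall S : {set G}, #|S| = 3 -> two_packed S].
Proof.
move=> n_bounds; exists (list_graph n (small_edges n)); split.
- exact: card_ord.
(* The list has n + 1 pairs for n = 4, 5 and n + 2 pairs for n = 6, 7, 8. *)
- apply: leq_trans (leq_mul (leqnn 5) (card_edges_list_graph n (small_edges n))) _.
  by case: n n_bounds => [|[|[|[|[|[|[|[|[|]]]]]]]]].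
- move=> S; apply: two_packed_list_graph.
    by case: n n_bounds {S} => [|[|[|[|[|[|[|[|[|]]]]]]]]].
  by case: n n_bounds {S} => [|[|[|[|[|[|[|[|[|]]]]]]]]] // _; vm_compute.
Qed.

(** * Rounding and conclusion *)

Lemma ceil_size_le (n e : nat) :
  (Num.ceil (6 / 5 * n%:R : rat) <= e%:Z)%R = (6 * n <= 5 * e).
Proof.
rewrite Num.Theory.real_ceil_le_int ?Num.Theory.num_real //.
have -> : ((e%:Z)%:~R = e%:R :> rat)%R by [].
apply/idP/idP => h; last first.
  have {}h : ((6 * n)%:R <= (5 * e)%:R :> rat)%R by rewrite Num.Theory.ler_nat.
  by rewrite !GRing.natrM in h; lra.
by rewrite -(Num.Theory.ler_nat rat) !GRing.natrM; lra.
Qed.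

Lemma ceil_size_eq (n e : nat) :
  0 < n -> 6 * n <= 5 * e <= 6 * n + 4 -> (e%:Z = Num.ceil (6 / 5 * n%:R : rat))%R.
Proof.
case: e => [|e] n_gt0 /andP[lo hi]; first by lia.
(* The ceiling is at most [e.+1] but not at most [e], since 5(e + 1) <= 6n + 4 gives 5e < 6n. *)
have := ceil_size_le n e.+1; have := ceil_size_le n e; set c := Num.ceil _.
rewrite lo [6 * n <= 5 * e]leqNgt (_ : 5 * e < 6 * n); lia.
Qed.

Theorem theorem1 (n : nat) (n_gt0 : (0 < n)%N) :
  (forall G : sgraph, #|G| = n -> kappa3 G = 2 ->
     (Num.ceil (6 / 5 * n%:R : rat) <= #|edges G|%:Z)%R)
  /\
  ((4 <= n)%N -> n <> 9 -> n <> 10 ->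
     exists G : sgraph,
       [/\ #|G| = n, kappa3 G = 2
         & (#|edges G|%:Z = Num.ceil (6 / 5 * n%:R : rat))%R]).
Proof.
have lower (G : sgraph) : #|G| = n -> kappa3 G = 2 ->
    (Num.ceil (6 / 5 * n%:R : rat) <= #|edges G|%:Z)%R.
  by move=> <- k2; rewrite ceil_size_le size_lower ?k2.
split=> // n_ge4 n9 n10.
suff [G [Gn Ge GS]] : exists G : sgraph, [/\ #|G| = n, 5 * #|edges G| <= 6 * n + 4
    & forall S : {set G}, #|S| = 3 -> two_packed S].
  have k2 : kappa3 G = 2 by apply: kappa3_eq2; rewrite ?Gn.
  exists G; split=> //; apply: ceil_size_eq => //.
  by rewrite Ge -Gn size_lower ?k2.
have [n_le8|n_gt8] := leqP n 8; first by apply: small_graph; rewrite n_ge4.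
(* This is n / 5 rounded up, so n = 5k - j with j <= 4; excluding 9 and 10 leaves n >= 11, hence k
   >= 3. *)
pose k := (n + 4) %/ 5.
have [||G [Gn Ge GS]] := @suppressed_mobius k (5 * k - n) two_packed_mobius3.
- by rewrite /k; lia.
- by rewrite /k; lia.
(* For n = 5k - j, 5(6k - j) = 6n + j, within the slack of 4. *)
by exists G; split=> //; move: Gn Ge; rewrite /k; lia.
Qed.
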